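(* Let $\mathcal{H}$ be a real Hilbert space, let $f_1,\dots,f_k:\mathcal{H}\to\mathbb{R}$ be locally Lipschitz continuous, $f=(f_1,\dots,f_k)$, and let $\varepsilon\ge0$. (a) If $x\in\mathcal{H}$ is locally weakly Pareto optimal for the minimization of $f$ over $\mathcal{H}$, then $0\in F_\varepsilon(x)$. (b) Let $x\in\mathcal{H}$ and $$\bar\xi:=\operatorname{argmin}_{\xi\in-F_\varepsilon(x)}\|\xi\|_*^2.$$ Then either $\bar\xi\ne0$ and $$\langle\bar\xi,\xi\rangle_*\le-\|\bar\xi\|_*^2<0\quad\text{for all }\xi\in F_\varepsilon(x),$$ or $\bar\xi=0$ and there is no $\tilde\xi\in\mathcal{H}^*$ with $\langle\tilde\xi,\xi\rangle_*<0$ for all $\xi\in F_\varepsilon(x)$.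
   Context: $\mathcal{H}^*$ is the topological dual, $R:\mathcal{H}\to\mathcal{H}^*$ the Riesz operator, $\langle\xi,\eta\rangle_*=\langle R^{-1}\xi,R^{-1}\eta\rangle$ and $\|\cdot\|_*$ the induced norm. A point $x^*\in\mathcal{H}$ is locally weakly Pareto optimal if there is $\delta>0$ such that no $x\in B_\delta(x^* )$ (open ball) satisfies $f_i(x)<f_i(x^* )$ for all $i=1,\dots,k$. Locally Lipschitz means Lipschitz on a neighbourhood of each point. Generalized directional derivative: $g^\circ(x;v)=\limsup_{y\to x,\,t\searrow0}\frac{g(y+tv)-g(y)}{t}$. Clarke subdifferential: $\partial g(x)=\{\xi\in\mathcal{H}^*:g^\circ(x;v)\ge\xi(v)\ \forall v\in\mathcal{H}\}$. Goldstein $\varepsilon$-subdifferential: $\partial_\varepsilon g(x)=\overline{\operatorname{conv}}\big(\bigcup_{\|y-x\|\le\varepsilon}\partial g(y)\big)$, where $\overline{\operatorname{conv}}$ is the closure of the convex hull. $F_\varepsilon(x)=\overline{\operatorname{conv}}\big(\bigcup_{i=1}^k\partial_\varepsilon f_i(x)\big)$. *)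

(* Defs.v *)
From HB Require Import structures.
From mathcomp Require Import all_boot all_order all_algebra sesquilinear.
From mathcomp Require Import all_classical all_reals all_analysis.
From mathcomp Require Import ring lra.

Set Implicit Arguments.
Unset Strict Implicit.
Unset Printing Implicit Defensive.
Import Order.TTheory GRing.Theory Num.Theory.
Import numFieldNormedType.Exports.
Local Open Scope classical_set_scope.
Local Open Scope ring_scope.

HB.mixin Record CompleteNormedModule_isHilbert (R : realType) V
    of CompleteNormedModule R V := {
  inner : {dot V for @idfun R} ;
  norm_inner : forall x : V, `|x| = Num.sqrt (inner x x)
}.

#[short(type="hilbertType")]
HB.structure Definition Hilbert (R : realType) :=
  {V of CompleteNormedModule R V & CompleteNormedModule_isHilbert R V}.

Section inner_theory.
Context {R : realType} {H : hilbertType R}.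
Implicit Types x y z : H.

(* Restatements of the bilinearity lemmas keyed on inner itself, which the
   generic rewriting rules turn into its underlying bilinear map. *)
Lemma innerDl x y z : inner (x + y) z = inner x z + inner y z.
Proof. exact: linearDl. Qed.

Lemma innerDr x y z : inner z (x + y) = inner z x + inner z y.
Proof. exact: linearDr. Qed.

Lemma innerZl a x z : inner (a *: x) z = a * inner x z.
Proof. exact: linearZl_LR. Qed.

Lemma innerZr a x z : inner z (a *: x) = a * inner z x.
Proof. exact: linearZr_LR. Qed.

Lemma inner0l z : inner 0 z = 0.
Proof. exact: linear0l. Qed.

Lemma innerC x y : inner x y = inner y x.
Proof. by rewrite (hermC inner) expr0 mul1r. Qed.

Lemma inner_ge0 x : 0 <= inner x x.
Proof.
have [->|x0] := eqVneq x 0; first by rewrite inner0l.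
by rewrite ltW// neq0_dnorm_gt0.
Qed.

Lemma sqr_norm_inner x : `|x| ^+ 2 = inner x x.
Proof. by rewrite norm_inner sqr_sqrtr// inner_ge0. Qed.

Lemma sqr_normD x y : `|x + y| ^+ 2 = `|x| ^+ 2 + `|y| ^+ 2 + inner x y *+ 2.
Proof.
rewrite !sqr_norm_inner innerDl !innerDr (innerC y x) mulr2n.
ring.
Qed.

Lemma inner_cauchy_schwarz x y : `|inner x y| <= `|x| * `|y|.
Proof.
have [->|y0] := eqVneq y 0; first by rewrite innerC inner0l !normr0 mulr0.
have ny : 0 < `|y| ^+ 2 by rewrite exprn_gt0// normr_gt0.
set t := - (inner x y / `|y| ^+ 2).
have : 0 <= `|x + t *: y| ^+ 2 by rewrite exprn_ge0.
rewrite sqr_normD normrZ exprMn real_normK ?num_real// innerZr.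
have -> : t ^+ 2 * `|y| ^+ 2 = inner x y ^+ 2 / `|y| ^+ 2.
  by rewrite /t; field; rewrite normr_eq0.
have -> : (t * inner x y) *+ 2 = - (inner x y ^+ 2 / `|y| ^+ 2) *+ 2.
  by rewrite /t -mulr_natl -[RHS]mulr_natl; field; rewrite normr_eq0.
rewrite mulr2n => h.
have : inner x y ^+ 2 / `|y| ^+ 2 <= `|x| ^+ 2 by lra.
rewrite ler_pdivrMr// -exprMn => /ler_wsqrtr.
by rewrite !sqrtr_sqr (ger0_norm (mulr_ge0 _ _)).
Qed.

(* A set closed under midpoints, closed and nonempty, has an element of
   minimal norm. *)
Lemma min_norm_exists (A : set H) : A !=set0 -> closed A ->
  (forall x y, A x -> A y -> A (2^-1 *: (x + y))) ->
  exists2 p, A p & forall y, A y -> `|p| <= `|y|.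
Proof.
move=> [a Aa] cA mA.
pose S := [set `|y| ^+ 2 | y in A].
pose d := inf S.
have hS : has_inf S.
  split; first by exists (`|a| ^+ 2), a.
  by exists 0 => _ [y _ <-]; rewrite exprn_ge0.
have dle y : A y -> d <= `|y| ^+ 2.
  by move=> Ay; apply: ge_inf; [exact: hS.2|exists y].
pose L e := A `&` [set y | `|y| ^+ 2 < d + e].
have L0 e : 0 < e -> L e !=set0.
  by move=> e0; have [_ [y Ay <-] ye] := inf_adherent e0 hS; exists y.
pose F := filter_from [set e : R | 0 < e] L.
have FF : Filter F.
  apply: filter_from_filter; first by exists 1 => /=.
  move=> i j /= i0 j0; exists (Num.min i j); first by rewrite /= lt_min i0.
  move=> y [Ay] /= yij.
  by split; (split; [|rewrite /= (lt_le_trans yij)// lerD2l ge_min lexx ?orbT]).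
have PF : ProperFilter F.
  by apply: filter_from_proper => // e e0; exact: L0.
have cF : cauchy F.
  apply: cauchy_exP => e e0.
  have de0 : 0 < e ^+ 2 / 4 by rewrite divr_gt0// exprn_gt0.
  have [x [Ax /= xL]] := L0 _ de0.
  exists x; exists (e ^+ 2 / 4) => // y [Ay /= yL].
  rewrite -ball_normE /=.
  rewrite -ltr_sqr ?nnegrE ?(ltW e0)//.
  have := dle _ (mA _ _ Ax Ay).
  rewrite normrZ exprMn real_normK ?num_real// sqr_normD.
  rewrite sqr_normD normrN -scaleN1r innerZr mulN1r mulNrn.
  move: xL yL; set p := inner x y *+ 2.
  have -> : (2^-1 : R) ^+ 2 = 4^-1 by field.
  lra.
have /cvg_ex[/= p Fp] := @cauchy_cvg H F PF cF.
have Ap : A p.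
  apply: cA => U Up.
  have [e /= e0 LU] := Fp _ Up.
  by have [y Ly] := L0 _ e0; exists y; split; [exact: Ly.1|exact: LU].
exists p => // y Ay.
rewrite -ler_sqr ?nnegrE//; apply: le_trans (dle _ Ay).
apply/ler_addgt0Pr => e e0.
have Fp2 : `|z| ^+ 2 @[z --> F] --> `|p| ^+ 2.
  by under eq_fun do rewrite expr2; rewrite expr2; apply: cvgM; exact: cvg_norm Fp.
by apply: (cvgr_to_le Fp2); exists e => // z [_ /=] /ltW.
Qed.

End inner_theory.

Section dual.
Context {R : realType} (H : hilbertType R).

Definition continuous_functional : {pred H -> R^o} :=
  fun xi => `[< linear xi /\ continuous xi >].

Record dual := Dual {
  dual_val :> H -> R^o ;
  dual_valP : dual_val \in continuous_functional }.

HB.instance Definition _ := [isSub for dual_val].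
HB.instance Definition _ := [Choice of dual by <:].

Lemma continuous_functional_submod_closed :
  submod_closed continuous_functional.
Proof.
split.
  by apply/asboolP; split=> [a x y|x]; [rewrite /= scaler0 addr0|exact: cvg_cst].
move=> a xi eta /asboolP[lxi cxi] /asboolP[leta ceta]; apply/asboolP; split.
  move=> b x y; rewrite !fctE lxi leta !scalerDr !scalerA (mulrC a b).
  by rewrite addrACA.
by move=> x; apply: cvgD; [apply: cvgZr; exact: cxi|exact: ceta].
Qed.

HB.instance Definition _ := GRing.isSubmodClosed.Build R (H -> R^o)
  continuous_functional continuous_functional_submod_closed.
HB.instance Definition _ := [SubChoice_isSubLmodule of dual by <:].

Lemma dual_linear (xi : dual) : linear xi.
Proof. by have /asboolP[] := dual_valP xi. Qed.

Lemma dual_continuous (xi : dual) : continuous xi.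
Proof. by have /asboolP[] := dual_valP xi. Qed.

Lemma dualD (xi : dual) x y : xi (x + y) = xi x + xi y.
Proof. by rewrite -[in LHS](scale1r x) dual_linear scale1r. Qed.

Lemma dual0 (xi : dual) : xi 0 = 0.
Proof. by apply: (addrI (xi 0)); rewrite -dualD !addr0. Qed.

Lemma dualZ (xi : dual) a x : xi (a *: x) = a * xi x.
Proof. by rewrite -[in LHS](addr0 (a *: x)) dual_linear dual0 addr0. Qed.

Lemma inner_continuous_functional (x : H) : inner x \in continuous_functional.
Proof.
apply/asboolP; split; first by move=> a y z; rewrite innerDr innerZr.
move=> y; apply/cvgrPdist_lt => e e0; near=> z.
rewrite -mulN1r -innerZr -innerDr scaleN1r.
rewrite (le_lt_trans (inner_cauchy_schwarz _ _))//.
have x0 : 0 < `|x| + 1 by rewrite ltr_wpDl.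
rewrite (@le_lt_trans _ _ ((`|x| + 1) * `|y - z|))// ?ler_wpM2r ?lerDl//.
rewrite -ltr_pdivlMl// mulrC.
by near: z; apply: cvgr_dist_lt; [exact: cvg_id|exact: divr_gt0].
Unshelve. all: by end_near. Qed.

Definition riesz (x : H) : dual := Dual (inner_continuous_functional x).

Lemma riesz_surjective (xi : dual) : exists x, riesz x = xi.
Proof.
have [xi0|/existsNP[a /eqP xia]] := pselect (forall y, xi y = 0).
  by exists 0; apply: val_inj; apply/funext => y /=; rewrite inner0l xi0.
pose A := [set x | xi x = 1].
have [||x y|p p1 pmin] := @min_norm_exists R H A.
- by exists ((xi a)^-1 *: a); rewrite /A/= dualZ mulVf.
- apply: (@closed_comp _ _ xi [set r | r = 1]); last exact: closed_eq.
  by move=> x _; exact: dual_continuous.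
- by rewrite /A/= dualZ dualD => -> ->; rewrite mulVf// pnatr_eq0.
have np : 0 < `|p| ^+ 2.
  rewrite exprn_gt0// normr_gt0; apply/eqP => p0.
  by move: p1; rewrite /A/= p0 dual0 => /esym/eqP; rewrite oner_eq0.
have orth k : xi k = 0 -> inner p k = 0.
  move=> xik; have [->|k0] := eqVneq k 0; first by rewrite innerC inner0l.
  have nk : 0 < `|k| ^+ 2 by rewrite exprn_gt0// normr_gt0.
  set t := - (inner p k / `|k| ^+ 2).
  have /pmin : A (p + t *: k) by rewrite /A/= dualD dualZ xik mulr0 addr0.
  rewrite -ler_sqr ?nnegrE// sqr_normD normrZ exprMn real_normK ?num_real//.
  rewrite innerZr.
  have -> : t ^+ 2 * `|k| ^+ 2 = inner p k ^+ 2 / `|k| ^+ 2.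
    by rewrite /t; field; rewrite normr_eq0.
  have -> : (t * inner p k) *+ 2 = - (inner p k ^+ 2 / `|k| ^+ 2) *+ 2.
    by rewrite /t -mulr_natl -[RHS]mulr_natl; field; rewrite normr_eq0.
  rewrite mulr2n => h.
  have : inner p k ^+ 2 / `|k| ^+ 2 <= 0 by lra.
  rewrite ler_pdivrMr// mul0r => h0.
  by apply/eqP; rewrite -sqrf_eq0 eq_le h0 sqr_ge0.
exists ((`|p| ^+ 2)^-1 *: p); apply: val_inj; apply/funext => y /=.
rewrite innerZl -[y in LHS](subrK (xi y *: p)) innerDr orth.
  by rewrite add0r innerZr -sqr_norm_inner mulrCA mulVf ?mulr1 ?gt_eqF.
by rewrite -scaleNr dualD dualZ p1 mulr1 subrr.
Qed.

Definition riesz_inv (xi : dual) : H := sval (cid (riesz_surjective xi)).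

Lemma riesz_invK : cancel riesz_inv riesz.
Proof. by move=> xi; rewrite /riesz_inv; case: cid. Qed.

Lemma rieszD x y : riesz (x + y) = riesz x + riesz y.
Proof. by apply: val_inj; apply/funext => z /=; rewrite innerDl. Qed.

Lemma rieszZ a x : riesz (a *: x) = a *: riesz x.
Proof. by apply: val_inj; apply/funext => z /=; rewrite innerZl. Qed.

Lemma riesz_inj : injective riesz.
Proof.
move=> x y xy; apply/eqP; rewrite -subr_eq0 -normr_eq0 -sqrf_eq0.
rewrite sqr_norm_inner innerDl -scaleN1r innerZl.
have -> : inner x (x + -1 *: y) = inner y (x + -1 *: y).
  by have /(congr1 (fun xi : dual => xi (x + -1 *: y))) := xy.
by rewrite mulN1r subrr.
Qed.

Lemma rieszK : cancel riesz riesz_inv.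
Proof. by move=> x; apply: riesz_inj; rewrite riesz_invK. Qed.

Lemma riesz_invD xi eta : riesz_inv (xi + eta) = riesz_inv xi + riesz_inv eta.
Proof. by apply: riesz_inj; rewrite rieszD !riesz_invK. Qed.

Lemma riesz_invZ a xi : riesz_inv (a *: xi) = a *: riesz_inv xi.
Proof. by apply: riesz_inj; rewrite rieszZ !riesz_invK. Qed.

Definition dual_inner (xi eta : dual) : R :=
  inner (riesz_inv xi) (riesz_inv eta).

Definition dual_norm (xi : dual) : R := Num.sqrt (dual_inner xi xi).

Lemma dual_normE xi : dual_norm xi = `|riesz_inv xi|.
Proof. by rewrite norm_inner. Qed.

Lemma ler_dual_normD xi eta :
  dual_norm (xi + eta) <= dual_norm xi + dual_norm eta.
Proof. by rewrite !dual_normE riesz_invD ler_normD. Qed.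

Lemma dual_normZ a xi : dual_norm (a *: xi) = `|a| * dual_norm xi.
Proof. by rewrite !dual_normE riesz_invZ normrZ. Qed.

Lemma dual_norm0_eq0 xi : dual_norm xi = 0 -> xi = 0.
Proof.
rewrite dual_normE => /normr0_eq0 xi0.
by rewrite -(riesz_invK xi) xi0 -(scale0r 0) rieszZ scale0r.
Qed.

(* `|xi| is dual_norm xi, and the topology of the dual is the one it induces. *)
HB.instance Definition _ := Lmodule_isNormed.Build R dual
  ler_dual_normD dual_normZ dual_norm0_eq0.

Lemma norm_dualE (xi : dual) : `|xi| = dual_norm xi.
Proof. by []. Qed.

End dual.

Definition locally_lipschitz {R : realType} {V : normedModType R}
    (g : V -> R) :=
  forall x : V, exists2 U, nbhs x U & [lipschitz g z | z in U].

Definition closed_convex_hull {R : realType} {V : normedModType R}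
    (A : set V) : set V :=
  closure (smallest (@convex_set R V) A).

Definition argmin {T : Type} {R : realType} (A : set T) (phi : T -> R) :=
  [set x | A x /\ forall y, A y -> phi x <= phi y].

Section clarke.
Context {R : realType} {H : hilbertType R}.
Implicit Types (g : H -> R) (x v : H) (eps : R).

Definition clarke_derivative g x v : \bar R :=
  limf_esup (fun p : H * R => ((g (p.1 + p.2 *: v) - g p.1) / p.2)%:E)
    (filter_prod (nbhs x) 0^'+).

Definition clarke_subdifferential g x : set (dual H) :=
  [set xi | forall v, ((xi v)%:E <= clarke_derivative g x v)%E].

(* The library's closed_ball is the closure of an open ball, which is empty
   for eps = 0; hence the explicit condition on the norm. *)
Definition goldstein_subdifferential eps g x : set (dual H) :=
  closed_convex_hull
    (\bigcup_(y in [set y | `|y - x| <= eps]) clarke_subdifferential g y).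

Definition goldstein_hull eps k (f : 'I_k -> H -> R) x : set (dual H) :=
  closed_convex_hull
    (\bigcup_(i in [set: 'I_k]) goldstein_subdifferential eps (f i) x).

Definition locally_weakly_pareto k (f : 'I_k -> H -> R) x :=
  exists2 delta : R, 0 < delta &
    ~ exists2 y, ball x delta y & forall i, f i y < f i x.

End clarke.

(* Main.v *)
Require Import Defs.
From mathcomp Require Import all_boot all_order all_algebra.
From mathcomp Require Import all_classical all_reals all_analysis.
From mathcomp Require Import ring lra.

Import Order.TTheory GRing.Theory Num.Theory.
Import numFieldNormedType.Exports.
Local Open Scope classical_set_scope.
Local Open Scope ring_scope.

(** Write [F] for the hull [goldstein_hull eps f x], a nonempty closed convex
    subset of the dual. Carried to the Hilbert space by the Riesz isometry, it
    has a point [eta] of least norm, and [eta] satisfies the variational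
    inequality [|eta|^2 <= <eta, xi>] on [F], since otherwise a small step from
    [eta] towards [xi] would decrease the norm ([min_norm_variational],
    [least_norm_dual]). Hence [- eta] is the only minimizer of the norm on
    [- F] ([argmin_oppE]) and, when it is nonzero, the inequality of (b) is the
    variational inequality with its sign changed. When [eta = 0], zero lies
    in [F], and every functional [<xitilde, .>] vanishes at zero.

    For (a), suppose [eta <> 0] and let [v] be the Riesz representative of
    [- eta]. Every Clarke subgradient of every [f i] at [x] lies in [F], so
    it takes a negative value at [v]. If the generalized directional derivative
    of [f i] at [x] along [v] is itself the value at [v] of some subgradient,
    that derivative is negative, each [f i] decreases strictly along [v] for
    all small steps, and [x] is not locally weakly Pareto optimal.

    The remaining point is this attainment ([clarke_derivative_attained]),
    which also shows that [F] is nonempty. For a locally Lipschitz [g] the map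
    [v |-> g^o(x; v)] is finite, bounded by a multiple of the norm and sublinear
    ([clarke_derivative_real], [clarke_derivative_sublinear]), so the analytic
    form of the Hahn-Banach theorem ([hahn_banach]) gives a linear functional
    below it with the same value at a prescribed [v]; the bound makes that
    functional continuous. *)

(** * Sublinear functionals and the Hahn-Banach theorem *)

(** Only the inequality is asked in the homogeneity condition: applied to the
    inverse of a positive factor it yields equality ([sublinearZ]), and with
    [a = 0] and subadditivity it yields [p 0 = 0] ([sublinear0]). *)
Definition sublinear {R : realType} {V : lmodType R} (p : V -> R) :=
  (forall x y, p (x + y) <= p x + p y) /\
  (forall a x, 0 <= a -> p (a *: x) <= a * p x).

Section hahn_banach.
Context {R : realType} {V : lmodType R}.
Implicit Types (p q : V -> R) (x y v : V).

Lemma sublinear0 p : sublinear p -> p 0 = 0.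
Proof.
move=> [pD pZ]; have := pD 0 0; have := pZ 0 0 (lexx _).
rewrite scale0r addr0 mul0r; lra.
Qed.

Lemma sublinearN p x : sublinear p -> - p (- x) <= p x.
Proof.
move=> sp; have := sp.1 (- x) x; rewrite addNr (sublinear0 p sp); lra.
Qed.

(** Covers the two infima that Hahn-Banach needs: along a chain of sublinear
    functionals, and along the translates of a single one, whose members
    are not sublinear individually. *)
Lemma sublinear_inf (I : Type) (D : set I) (q : I -> V -> R) :
  D !=set0 ->
  (forall x, has_lbound [set q i x | i in D]) ->
  (forall i j x y, D i -> D j -> exists2 k, D k &
     q k (x + y) <= q i x + q j y) ->
  (forall i a x, D i -> 0 <= a -> exists2 k, D k & q k (a *: x) <= a * q i x) ->
  sublinear (fun x => inf [set q i x | i in D]).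
Proof.
move=> [i0 Di0] qlb qD qZ.
have hinf x : has_inf [set q i x | i in D] by split=> //; exists (q i0 x), i0.
have inf_le i x : D i -> inf [set q i x | i in D] <= q i x.
  by move=> Di; apply: ge_inf => //; exists i.
split=> [x y|a x a0]; apply/ler_addgt0Pr => e e0.
  have e2 : 0 < e / 2 by rewrite divr_gt0.
  have [_ [i Di <-] ix] := inf_adherent e2 (hinf x).
  have [_ [j Dj <-] jy] := inf_adherent e2 (hinf y).
  have [k Dk kxy] := qD _ _ x y Di Dj.
  have := inf_le k (x + y) Dk; lra.
(* Dividing by a + 1 rather than a covers the case a = 0. *)
have a1 : 0 < a + 1 by rewrite ltr_wpDl.
have ea : 0 < e / (a + 1) by rewrite divr_gt0.
have [_ [i Di <-] ix] := inf_adherent ea (hinf x).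
have [k Dk kax] := qZ _ a x Di a0.
apply: le_trans (inf_le k _ Dk) (le_trans kax _).
apply: (@le_trans _ _ (a * (inf [set q i x | i in D] + e / (a + 1)))).
  by rewrite ler_wpM2l// ltW.
rewrite mulrDr lerD2l mulrCA ler_piMr ?(ltW e0)//.
by rewrite ler_pdivrMr// mul1r lerDl.
Qed.

Lemma sublinearZ p a x : sublinear p -> 0 <= a -> p (a *: x) = a * p x.
Proof.
move=> sp; rewrite le_eqVlt => /predU1P[<-|a0].
  by rewrite scale0r mul0r sublinear0.
apply/eqP; rewrite eq_le sp.2 ?(ltW a0)//= -ler_pdivlMl//.
rewrite -[X in p X <= _](scale1r x) -(mulVf (lt0r_neq0 a0)) -scalerA.
by rewrite sp.2// invr_ge0 ltW.
Qed.

(** The witness is [q x := inf_(t >= 0) (p (x + t v) - t p v)], the largest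
    sublinear minorant of [p] whose value at [- v] is at most [- p v]; the
    last bound gives that value at [x = - v]. *)
Lemma sublinear_shift p v : sublinear p ->
  exists q, [/\ sublinear q, forall x, q x <= p x &
                forall x, q x <= p (x + v) - p v].
Proof.
move=> sp; have [pD _] := sp.
pose r (t : R) x := p (x + t *: v) - t * p v.
pose D := [set t : R | 0 <= t].
have rlb x : has_lbound [set r t x | t in D].
  exists (- p (- x)) => _ [t /= t0 <-]; rewrite /r.
  have := pD (x + t *: v) (- x); rewrite addrAC subrr add0r sublinearZ//; lra.
have r_inf t x : 0 <= t -> inf [set r t x | t in D] <= r t x.
  by move=> t0; apply: ge_inf => //; exists t.
exists (fun x => inf [set r t x | t in D]); split.
- apply: sublinear_inf => //; first by exists 0; exact: lexx.
    move=> s t x y /= s0 t0; exists (s + t) => /=; first exact: addr_ge0.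
    rewrite /r; have := pD (x + s *: v) (y + t *: v).
    by rewrite addrACA -scalerDl; lra.
  move=> t a x /= t0 a0; exists (a * t) => /=; first exact: mulr_ge0.
  by rewrite /r -scalerA -scalerDr sublinearZ// mulrBr mulrA.
- by move=> x; have := r_inf 0 x (lexx _); rewrite /r scale0r addr0 mul0r subr0.
- by move=> x; have := r_inf 1 x ler01; rewrite /r scale1r mul1r.
Qed.

(** Zorn's lemma for the reversed pointwise order. The infimum of a chain stays
    finite because a sublinear [q <= p] satisfies [- p (- x) <= q x]. *)
Lemma minimal_sublinear p : sublinear p ->
  exists q, [/\ sublinear q, forall x, q x <= p x &
    forall r, sublinear r -> (forall x, r x <= q x) -> r = q].
Proof.
move=> sp.
pose T := {q : V -> R | sublinear q /\ forall x, q x <= p x}.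
pose le (q r : T) := `[< forall x, sval r x <= sval q x >].
have [|q r s /asboolP qr /asboolP rs|[q q0] [r r0] /asboolP/= qr /asboolP/= rq
     |A totA|[q [sq qp]] qmin] := @Zorn T le.
- by move=> q; apply/asboolP.
- by apply/asboolP => x; exact: le_trans (rs x) (qr x).
- by apply/eq_exist/funext => x; apply/eqP; rewrite eq_le rq qr.
- have [->|/set0P A0] := eqVneq A set0.
    by have pT : T := exist _ p (conj sp (fun=> lexx _)); exists pT => q [].
  have Alb x : has_lbound [set sval q x | q in A].
    exists (- p (- x)) => _ [[q [sq qp]] _ <-]/=.
    by rewrite (le_trans _ (sublinearN _ x sq))// lerN2.
  have inf_le (q : T) x : A q -> inf [set sval q x | q in A] <= sval q x.
    by move=> Aq; apply: ge_inf => //; exists q.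
  have sinf : sublinear (fun x => inf [set sval q x | q in A]).
    apply: sublinear_inf => // [q r x y Aq Ar|q a x Aq a0]; last first.
      by exists q => //; rewrite sublinearZ//; exact: (svalP q).1.
    have [/asboolP qr|/asboolP rq] := totA _ _ Aq Ar; [exists r|exists q] => //.
      by apply: le_trans ((svalP r).1.1 x y) _; rewrite lerD2r.
    by apply: le_trans ((svalP q).1.1 x y) _; rewrite lerD2l.
  have infp x : inf [set sval q x | q in A] <= p x.
    have [q Aq] := A0; exact: le_trans (inf_le q x Aq) ((svalP q).2 x).
  unshelve eexists (exist _ (fun x => inf [set sval q x | q in A]) _).
    by split.
  move=> q Aq.
  by apply/asboolP => x; exact: inf_le.
exists q; split=> // r sr rq.
have rp x : r x <= p x by exact: le_trans (rq x) (qp x).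
pose r' : T := exist _ r (conj sr rp).
by have /(congr1 sval) := qmin r' (asboolT rq).
Qed.

(** A minimal sublinear functional is linear: by minimality it equals each of
    its own shifts, which makes it superadditive. Taking it below the shift of
    [p] along [v], rather than below [p], makes it agree with [p] at [v]. *)
Lemma hahn_banach p v : sublinear p ->
  exists l : V -> R,
    [/\ linear (l : V -> R^o), forall x, l x <= p x & l v = p v].
Proof.
move=> sp.
have [q [sq qp qv]] := sublinear_shift p v sp.
have [l [sl lq lmin]] := minimal_sublinear q sq.
have lD x y : l (x + y) = l x + l y.
  apply/eqP; rewrite eq_le sl.1/=.
  have [r [sr rl ry]] := sublinear_shift l y sl.
  by have := ry x; rewrite (lmin r sr rl); lra.
have lN x : l (- x) = - l x.
  by apply/eqP; rewrite -addr_eq0 -lD addNr sublinear0.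
exists l; split=> [a x y|x|].
- rewrite lD; congr (_ + _).
  have [a0|/ltW a0] := leP 0 a; first by rewrite sublinearZ.
  by rewrite -(opprK a) scaleNr lN sublinearZ ?oppr_ge0// -mulNr.
- exact: le_trans (lq x) (qp x).
apply/eqP; rewrite eq_le (le_trans (lq v) (qp v))/=.
have := le_trans (lq _) (qv (- v)).
by rewrite lN addNr sublinear0//; lra.
Qed.

End hahn_banach.

(** * The generalized directional derivative *)

Section clarke_calculus.
Context {R : realType} {H : hilbertType R}.
Implicit Types (g : H -> R) (x y v w : H).

Definition diff_quotient g v (p : H * R) : R :=
  (g (p.1 + p.2 *: v) - g p.1) / p.2.

Lemma clarke_derivative_le g x v (r : R) :
  (\forall p \near filter_prod (nbhs x) 0^'+, diff_quotient g v p <= r) ->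
  (clarke_derivative g x v <= r%:E)%E.
Proof.
move=> qr; apply: ge_ereal_inf.
exists (ereal_sup ((fun p => (diff_quotient g v p)%:E) @`
   [set p | diff_quotient g v p <= r])); first by eexists; first exact: qr.
by apply: ge_ereal_sup => _ [p pr <-]; rewrite lee_fin.
Qed.

Lemma clarke_derivative_lt g x v (r : R) : (clarke_derivative g x v < r%:E)%E ->
  \forall p \near filter_prod (nbhs x) 0^'+, diff_quotient g v p < r.
Proof.
move=> /ereal_inf_ltP[_ [A FA <-] Ar]; apply: filterS FA => p Ap.
rewrite -lte_fin; apply: le_lt_trans Ar; apply: ereal_sup_ubound.
by exists p.
Qed.

(** A step along [v + w] is a step along [w] followed by one along [v] from the
    shifted base point. Since the limsup lets the base point move, this is what
    makes the generalized derivative subadditive. *)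
Lemma diff_quotientD g v w p : diff_quotient g (v + w) p =
  diff_quotient g v (p.1 + p.2 *: w, p.2) + diff_quotient g w p.
Proof.
rewrite /diff_quotient/= -mulrDl scalerDr addrA addrAC; congr (_ * _).
by rewrite (addrAC p.1) addrA subrK.
Qed.

Lemma diff_quotientZ g a v p : a != 0 ->
  diff_quotient g (a *: v) p = a * diff_quotient g v (p.1, a * p.2).
Proof.
move=> a0; rewrite /diff_quotient/= scalerA (mulrC p.2) invfM.
by rewrite [RHS]mulrCA mulVKf.
Qed.

Lemma cvg_shift_base x w :
  (p.1 + p.2 *: w, p.2) @[p --> filter_prod (nbhs x) (0:R)^'+] -->
  filter_prod (nbhs x) (0:R)^'+.
Proof.
apply: (@cvg_pair _ _ _ _ (nbhs x) (0:R)^'+); last exact: cvg_snd.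
rewrite -[X in _ --> nbhs X]addr0 -[X in _ --> nbhs (_ + X)](scale0r w).
apply: cvgD; first exact: cvg_fst.
apply: cvgZl; apply: cvg_trans cvg_snd _; exact: cvg_within.
Qed.

Lemma cvg_scale_step x (a : R) : 0 < a ->
  (p.1, a * p.2) @[p --> filter_prod (nbhs x) (0:R)^'+] -->
  filter_prod (nbhs x) (0:R)^'+.
Proof.
move=> a0.
apply: (@cvg_pair _ _ _ _ (nbhs x) (0:R)^'+); first exact: cvg_fst.
suff at0 : a * t @[t --> (0:R)^'+] --> (0:R)^'+.
  exact: (cvg_comp _ (fun t : R => a * t) cvg_snd at0).
move=> P P0.
have a00 : a * t @[t --> (0:R)] --> (0:R).
  by rewrite -[X in _ --> X](mulr0 a); apply: cvgMr; exact: cvg_id.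
have {}a00 : \forall t \near (0:R), 0 < a * t -> P (a * t) by exact: a00 P0.
by apply: filterS a00 => t aP t0; apply: aP; exact: mulr_gt0.
Qed.

Lemma diff_quotient_bounded g x : locally_lipschitz g ->
  exists2 K : R, 0 < K & forall v,
    \forall p \near filter_prod (nbhs x) 0^'+,
      `|diff_quotient g v p| <= K * `|v|.
Proof.
move=> /(_ x)[U Ux /pinfty_ex_gt0[K K0 gK]]; exists K => // v.
have Ubase : \forall p \near filter_prod (nbhs x) (0:R)^'+, U p.1.
  exact: cvg_fst Ux.
have Ushift : \forall p \near filter_prod (nbhs x) (0:R)^'+,
    U (p.1 + p.2 *: v).
  exact: (cvg_shift_base x v _ Ubase).
have step_gt0 : \forall p \near filter_prod (nbhs x) (0:R)^'+, 0 < p.2.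
  exact: (cvg_snd (nbhs_right_gt (0:R))).
near=> p; have p0 : 0 < p.2 by near: p.
rewrite /diff_quotient normrM normfV (gtr0_norm p0) ler_pdivrMr//.
have := gK (p.1 + p.2 *: v, p.1); rewrite /= addrAC subrr add0r.
rewrite normrZ (gtr0_norm p0) mulrA mulrAC; apply.
by split; near: p.
Unshelve. all: by end_near. Qed.

(** The bound is the local Lipschitz estimate on the difference quotients; it
    rules out infinite values, so that real-valued arguments apply. *)
Lemma clarke_derivative_real g x : locally_lipschitz g ->
  exists p : H -> R, exists K : R, forall v,
    clarke_derivative g x v = (p v)%:E /\ `|p v| <= K * `|v|.
Proof.
move=> /diff_quotient_bounded-/(_ x)[K K0 gK].
have ub v : (clarke_derivative g x v <= (K * `|v|)%:E)%E.
  apply: clarke_derivative_le; apply: filterS (gK v) => p.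
  exact: le_trans (ler_norm _).
have lb v : ((- (K * `|v|))%:E <= clarke_derivative g x v)%E.
  rewrite leNgt; apply/negP => /clarke_derivative_lt qlt.
  have [p []] := filter_ex (filterI qlt (gK v)).
  by rewrite ler_norml => pl /andP[/(lt_le_trans pl)]; rewrite ltxx.
exists (fun v => fine (clarke_derivative g x v)), K => v.
have fv : clarke_derivative g x v \is a fin_num.
  rewrite fin_numE -ltNye -ltey (lt_le_trans _ (lb v)) ?ltNyr//.
  by rewrite (le_lt_trans (ub v)) ?ltry.
by rewrite fineK//; split=> //; rewrite ler_norml -!lee_fin fineK// lb ub.
Qed.

Lemma clarke_derivative_sublinear g x (p : H -> R) :
  (forall v, clarke_derivative g x v = (p v)%:E) -> sublinear p.
Proof.
move=> gp.
have lt_near v (e : R) : 0 < e ->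
    \forall q \near filter_prod (nbhs x) 0^'+, diff_quotient g v q < p v + e.
  by move=> e0; apply: clarke_derivative_lt; rewrite gp lte_fin ltrDl.
split=> [v w|a v].
  apply/ler_addgt0Pr => e e0; rewrite -lee_fin -gp.
  have e2 : 0 < e / 2 by rewrite divr_gt0.
  apply: clarke_derivative_le.
  have shifted : \forall q \near filter_prod (nbhs x) (0:R)^'+,
      diff_quotient g v (q.1 + q.2 *: w, q.2) < p v + e / 2.
    exact: cvg_shift_base x w _ (lt_near v _ e2).
  apply: filterS2 shifted (lt_near w _ e2) => q.
  by rewrite diff_quotientD; lra.
rewrite le_eqVlt => /predU1P[<-|a0].
  rewrite scale0r mul0r -lee_fin -gp; apply: clarke_derivative_le.
  apply: nearW => q.
  by rewrite /diff_quotient scaler0 addr0 subrr mul0r.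
apply/ler_addgt0Pr => e e0; rewrite -lee_fin -gp.
have ea : 0 < e / a by rewrite divr_gt0.
apply: clarke_derivative_le.
have scaled : \forall q \near filter_prod (nbhs x) (0:R)^'+,
    diff_quotient g v (q.1, a * q.2) < p v + e / a.
  exact: cvg_scale_step x _ a0 _ (lt_near v _ ea).
apply: filterS scaled => q /ltW.
rewrite diff_quotientZ ?gt_eqF// -(ler_pM2l a0) mulrDr (mulrC e).
by rewrite mulVKf ?gt_eqF.
Qed.

Lemma bounded_linear_dual (l : H -> R) (K : R) :
  linear (l : H -> R^o) -> (forall v, `|l v| <= K * `|v|) ->
  exists xi : dual H, forall v, xi v = l v.
Proof.
move=> ll lK.
have lB x y : l x - l y = l (x - y).
  by have := ll (-1) y x; rewrite !scaleN1r addrC => <-; rewrite addrC.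
suff lcont : continuous (l : H -> R^o).
  have lP : (l : H -> R^o) \in @continuous_functional R H by apply/asboolP.
  by exists (Dual lP).
move=> x; apply/cvgrPdist_lt => e e0; near=> y.
rewrite lB (le_lt_trans (lK _))//.
have K1 : 0 < `|K| + 1 by rewrite ltr_wpDl.
rewrite (@le_lt_trans _ _ ((`|K| + 1) * `|x - y|))//.
  by rewrite ler_wpM2r// (le_trans (ler_norm K))// lerDl.
rewrite -ltr_pdivlMl// mulrC.
by near: y; apply: cvgr_dist_lt; [exact: cvg_id|exact: divr_gt0].
Unshelve. all: by end_near. Qed.

(** The generalized derivative is the support function of the subdifferential,
    with the supremum attained: the functional is the one that Hahn-Banach
    produces below [w |-> g^o(x; w)], tangent to it at [v]. *)
Lemma clarke_derivative_attained g x v : locally_lipschitz g ->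
  exists2 xi, clarke_subdifferential g x xi &
    clarke_derivative g x v = (xi v)%:E.
Proof.
move=> /clarke_derivative_real-/(_ x)[p [K pK]].
have gp w : clarke_derivative g x w = (p w)%:E by have [] := pK w.
have [l [ll lp lv]] :=
  hahn_banach p v (clarke_derivative_sublinear g x p gp).
have [|xi xil] := bounded_linear_dual l K ll.
  move=> w; have [_ pw] := pK w; have [_ pNw] := pK (- w).
  have lN : l (- w) = - l w.
    have l0 : l 0 = 0.
      by have := ll (-1) 0 0; rewrite scaler0 addr0 scaleN1r addNr.
    by have := ll (-1) w 0; rewrite addr0 l0 addr0 !scaleN1r.
  rewrite normrN in pNw.
  have := lp w; have := lp (- w); rewrite lN.
  move: pw pNw; rewrite !ler_norml => /andP[_ ?] /andP[_ ?]; lra.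
by exists xi => [w|]; rewrite gp xil ?lee_fin ?lv.
Qed.

(** The limsup runs over moving base points; restricting it to the fixed base
    point [x] bounds the one-sided quotients at [x] itself. *)
Lemma clarke_descent g x v : (clarke_derivative g x v < 0)%E ->
  \forall t \near (0:R)^'+, g (x + t *: v) < g x.
Proof.
move=> /clarke_derivative_lt q0.
have xt : (x, t) @[t --> (0:R)^'+] --> filter_prod (nbhs x) (0:R)^'+.
  apply: (@cvg_pair _ _ _ _ (nbhs x) (0:R)^'+); first exact: cvg_cst.
  exact: cvg_id.
near=> t; have t0 : 0 < t by [].
have : diff_quotient g v (x, t) < 0 by near: t; exact: xt q0.
by rewrite /diff_quotient/= ltr_pdivrMr// mul0r subr_lt0.
Unshelve. all: by end_near. Qed.

End clarke_calculus.

(** * Closed convex hulls *)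

Section convex_hull.
Context {R : realType} {V : normedModType R}.
Implicit Types A : set V.

Lemma sub_closed_convex_hull A : A `<=` closed_convex_hull A.
Proof. by move=> x Ax; apply: subset_closure; exact: sub_gen_smallest. Qed.

Lemma closed_convex_hull_closed A : closed (closed_convex_hull A).
Proof. exact: closed_closure. Qed.

(** Convex combinations pass to the closure one argument at a time, each time
    because the preimage of a closed set under [u |-> t u + (1 - t) v] is
    closed. *)
Lemma closed_convex_hull_convex A (t : R) x y : 0 <= t <= 1 ->
  closed_convex_hull A x -> closed_convex_hull A y ->
  closed_convex_hull A (t *: x + (1 - t) *: y).
Proof.
move=> t01.
have hull_convex u v : smallest (@convex_set R V) A u ->
    smallest (@convex_set R V) A v ->
    smallest (@convex_set R V) A (t *: u + (1 - t) *: v).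
  move=> Au Av M [cM AM].
  have := cM u v (Itv01 (andP t01).1 (andP t01).2).
  by rewrite !inE => cMt; apply: cMt; [apply: Au|apply: Av].
have closure_sub (B D : set V) : closed D -> B `<=` D -> closure B `<=` D.
  by move=> cD BD; rewrite closureE; exact: smallest_sub.
move=> Ax Ay.
have {}Ax v : smallest (@convex_set R V) A v ->
    closed_convex_hull A (t *: x + (1 - t) *: v).
  move=> Av; pose S := [set u | closed_convex_hull A (t *: u + (1 - t) *: v)].
  apply: (closure_sub _ S _ _ _ Ax) => [|u Au].
    apply: preimage_closed (closed_convex_hull_closed A) => u _.
    by apply: cvgD; [exact: cvgZr|exact: cvg_cst].
  by apply: subset_closure; exact: hull_convex.
pose S := [set v | closed_convex_hull A (t *: x + (1 - t) *: v)].
apply: (closure_sub _ S _ Ax _ Ay).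
apply: preimage_closed (closed_convex_hull_closed A) => v _.
by apply: cvgD; [exact: cvg_cst|exact: cvgZr].
Qed.

End convex_hull.

(** * Elements of least norm *)

Section projection.
Context {R : realType} {H : hilbertType R}.

(** First-order optimality: the norm cannot decrease on the segment from [p] to
    [y], so its derivative at [p] along that segment is nonnegative. *)
Lemma min_norm_variational (A : set H) : A !=set0 -> closed A ->
  (forall (t : R) x y, 0 <= t <= 1 ->
     A x -> A y -> A (t *: x + (1 - t) *: y)) ->
  exists2 p, A p & forall y, A y -> `|p| ^+ 2 <= inner p y.
Proof.
move=> A0 cA Aconv.
have [|p Ap pmin] := min_norm_exists A0 cA.
  move=> x y Ax Ay.
  have -> : 2^-1 *: (x + y) = (2^-1 : R) *: x + (1 - 2^-1) *: y.
    by rewrite scalerDr; congr (_ + _ *: _); field.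
  by apply: Aconv => //; lra.
exists p => // y Ay.
(* Expand |p|^2 <= |p + t (y - p)|^2 and divide by t; the conclusion is the
   limit t -> 0. *)
have step t : 0 < t -> t <= 1 ->
    2 * (`|p| ^+ 2 - inner p y) <= t * `|y - p| ^+ 2.
  move=> t0 t1.
  have /pmin : A (t *: y + (1 - t) *: p) by apply: Aconv => //; lra.
  have -> : t *: y + (1 - t) *: p = p + t *: (y - p).
    by rewrite scalerBr scalerBl scale1r addrCA addrA.
  rewrite -ler_sqr ?nnegrE// (sqr_normD p) normrZ exprMn real_normK ?num_real//.
  rewrite innerZr innerDr -(scaleN1r p) innerZr -sqr_norm_inner mulN1r scaleN1r.
  set a := `|p| ^+ 2; set b := inner p y; set c := `|y - p| ^+ 2 => h.
  rewrite -(ler_pM2l t0).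
  have -> : t * (t * c) = t ^+ 2 * c by rewrite expr2 mulrA.
  have -> : t * (2 * (a - b)) = - (t * (b - a)) *+ 2.
    by rewrite mulr2n; ring.
  rewrite !mulr2n in h *; lra.
apply/ler_addgt0Pr => e e0.
set c := `|y - p| ^+ 2 in step.
have c0 : 0 <= c by exact: exprn_ge0.
have c1 : 0 < c + 1 by lra.
(* With this step t <= 1 and t c <= e; the added 1 allows c = 0. *)
pose t := Num.min 1 (e / (c + 1)).
have t0 : 0 < t by rewrite lt_min ltr01 divr_gt0.
have t1 : t <= 1 by rewrite ge_min lexx.
have := step t t0 t1.
have : t * c <= e.
  apply: (@le_trans _ _ (e / (c + 1) * c)).
    by rewrite ler_wpM2r// ge_min lexx orbT.
  rewrite mulrAC ler_pdivrMr// mulrDr mulr1; lra.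
lra.
Qed.

End projection.

Section least_norm_functional.
Context {R : realType} {H : hilbertType R}.
Implicit Types xi eta : dual H.

Lemma riesz_continuous : continuous (@riesz R H).
Proof.
move=> x; apply/cvgrPdist_lt => e e0; near=> y.
rewrite -scaleN1r -rieszZ -rieszD scaleN1r norm_dualE dual_normE rieszK.
by near: y; exact: cvgr_dist_lt.
Unshelve. all: by end_near. Qed.

Lemma dual_innerE xi eta : dual_inner xi eta = eta (riesz_inv xi).
Proof. by rewrite -[in RHS](riesz_invK eta) /dual_inner innerC. Qed.

Lemma least_norm_dual (A : set (dual H)) : closed_convex_hull A !=set0 ->
  exists2 eta, closed_convex_hull A eta &
    forall xi, closed_convex_hull A xi -> `|eta| ^+ 2 <= dual_inner eta xi.
Proof.
move=> [a Aa]; pose B := @riesz R H @^-1` closed_convex_hull A.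
have [|||p Bp pB] := @min_norm_variational R H B.
- by exists (riesz_inv a); rewrite /B/= riesz_invK.
- apply: preimage_closed (closed_convex_hull_closed A) => x _.
  exact: riesz_continuous.
- move=> t x y t01 Bx By; rewrite /B/= rieszD !rieszZ.
  exact: closed_convex_hull_convex.
exists (riesz p) => // xi Axi.
rewrite norm_dualE dual_normE /dual_inner rieszK; apply: pB.
by rewrite /B/= riesz_invK.
Qed.

(** Uniqueness is quantitative: the variational inequality gives
    [|xi - eta|^2 <= |xi|^2 - |eta|^2] on [A]. *)
Lemma argmin_oppE (A : set (dual H)) eta : A eta ->
  (forall xi, A xi -> `|eta| ^+ 2 <= dual_inner eta xi) ->
  argmin (-%R @` A) (fun xi => `|xi| ^+ 2) = [set - eta].
Proof.
move=> Aeta etaP.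
have dist xi : A xi -> `|xi - eta| ^+ 2 <= `|xi| ^+ 2 - `|eta| ^+ 2.
  move=> /etaP; rewrite !norm_dualE !dual_normE riesz_invD -scaleN1r riesz_invZ.
  rewrite scaleN1r sqr_normD normrN -(scaleN1r (riesz_inv eta)) innerZr mulN1r.
  by rewrite innerC /dual_inner mulNrn mulr2n; lra.
apply/seteqP; split=> [_ [[xi Axi <-] ximin]|_ ->].
  have /ximin : (-%R @` A) (- eta) by exists eta.
  rewrite /= !normrN => le_xi_eta; congr (- _).
  apply/eqP; rewrite -subr_eq0 -normr_eq0 -sqrf_eq0 eq_le exprn_ge0// andbT.
  by apply: le_trans (dist xi Axi) _; rewrite subr_le0.
split=> [|_ [xi Axi <-]]; first by exists eta.
by rewrite !normrN -subr_ge0 (le_trans _ (dist xi Axi))// exprn_ge0.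
Qed.

End least_norm_functional.

(** * Descent directions and Pareto optimality *)

Section multiobjective.
Context {R : realType} {H : hilbertType R} {k : nat} (f : 'I_k -> H -> R).
Implicit Types x v : H.

(** The point [x] belongs to its own closed [eps]-ball, including for
    [eps = 0]. *)
Lemma clarke_sub_goldstein_hull (eps : R) i x : 0 <= eps ->
  clarke_subdifferential (f i) x `<=` goldstein_hull eps f x.
Proof.
move=> eps0 xi fxi; apply: sub_closed_convex_hull; exists i => //.
by apply: sub_closed_convex_hull; exists x => //=; rewrite subrr normr0.
Qed.

(** Attainment turns the sign of the subgradients at [v] into the sign of the
    derivative along [v]; finitely many objectives then share a step size. *)
Lemma common_descent_not_pareto x v : (forall i, locally_lipschitz (f i)) ->
  (forall i xi, clarke_subdifferential (f i) x xi -> xi v < 0) ->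
  ~ locally_weakly_pareto f x.
Proof.
move=> f_lip fv [d d0]; apply.
have desc : \forall t \near (0:R)^'+, forall i, f i (x + t *: v) < f i x.
  apply: filter_forall => i; apply: clarke_descent.
  have [xi fxi ->] := clarke_derivative_attained (f i) x v (f_lip i).
  by rewrite lte_fin; exact: fv fxi.
have xt : x + t *: v @[t --> (0:R)^'+] --> x.
  rewrite -[X in _ --> X]addr0 -[X in _ --> _ + X](scale0r v).
  apply: cvgD; first exact: cvg_cst.
  by apply: cvgZl; exact: cvg_within.
have in_ball : \forall t \near (0:R)^'+, ball x d (x + t *: v).
  exact: xt (nbhsx_ballx x d d0).
have [t [tball tdesc]] := filter_ex (filterI in_ball desc).
by exists (x + t *: v).
Qed.

End multiobjective.

Theorem corollary4p2 (R : realType) (H : hilbertType R) (k : nat)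
    (k_gt0 : (0 < k)%N) (f : 'I_k -> H -> R)
    (f_lip : forall i, locally_lipschitz (f i))
    (eps : R) (eps_ge0 : 0 <= eps) :
  (forall x : H, locally_weakly_pareto f x -> goldstein_hull eps f x 0)
  /\
  (forall x : H, exists xibar : dual H,
     argmin (-%R @` goldstein_hull eps f x) (fun xi => `|xi| ^+ 2)
       = [set xibar]
     /\
     ((xibar <> 0 /\
       forall xi, goldstein_hull eps f x xi ->
         dual_inner xibar xi <= - `|xibar| ^+ 2 /\ - `|xibar| ^+ 2 < 0)
      \/
      (xibar = 0 /\
       ~ exists xitilde : dual H,
           forall xi, goldstein_hull eps f x xi ->
             dual_inner xitilde xi < 0))).
Proof.
pose i0 := Ordinal k_gt0.
have dual_innerN (xi eta : dual H) :
    dual_inner (- xi) eta = - dual_inner xi eta.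
  by rewrite /dual_inner -scaleN1r riesz_invZ innerZl mulN1r.
have least x : exists2 eta, goldstein_hull eps f x eta &
    forall xi, goldstein_hull eps f x xi -> `|eta| ^+ 2 <= dual_inner eta xi.
  apply: least_norm_dual.
  have [xi fxi _] := clarke_derivative_attained (f i0) x 0 (f_lip i0).
  by exists xi; exact: (clarke_sub_goldstein_hull f eps i0 x).
split=> x; have [eta Feta etaP] := least x;
  have [eta0|eta_neq0] := eqVneq eta 0.
- by move=> _; rewrite -eta0.
- have eta_gt0 : 0 < `|eta| ^+ 2 by rewrite exprn_gt0// normr_gt0.
  (* All objectives decrease along the representative of - eta. *)
  move=> par; exfalso.
  apply: (common_descent_not_pareto f x (- riesz_inv eta) f_lip _ par).
  move=> i xi /(clarke_sub_goldstein_hull f eps i x eps_ge0)/etaP.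
  by rewrite -scaleN1r dualZ mulN1r oppr_lt0 dual_innerE; exact: lt_le_trans.
- exists 0; split; first by rewrite (argmin_oppE _ eta)// eta0 oppr0.
  right; split=> // -[xit /(_ 0)].
  rewrite -[X in goldstein_hull _ _ _ X]eta0 => /(_ Feta).
  by rewrite /dual_inner -(scale0r 0) riesz_invZ innerZr mul0r ltxx.
- exists (- eta); split; first exact: argmin_oppE.
  have eta_gt0 : 0 < `|eta| ^+ 2 by rewrite exprn_gt0// normr_gt0.
  left; split=> [/eqP|xi Fxi]; first by rewrite oppr_eq0 (negPf eta_neq0).
  by rewrite dual_innerN normrN lerN2 oppr_lt0 etaP.
Qed.
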